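(* Let $\ell,k\ge 1$ be integers, let $\epsilon,\delta,\xi\in(0,1)$, let $h\colon 2^{[\ell]}\to\mathbb R$ be a non-negative submodular function, and let $\mathcal O^{\pm}_h$ be an approximate oracle for $h$. The algorithm $\mathrm{ASMC}(\mathcal O^{\pm}_h,\epsilon,\delta,\xi,k)$ described in the context satisfies the following conditions. (1) If there exists a set $J\subseteq[\ell]$ such that $|J|\ge \ell-k$ and $h(J)\le\epsilon$, then the algorithm accepts with probability at least $1-\delta$. (2) If for every set $J\subseteq[\ell]$ such that $|J|\ge \ell-2(1+\frac{\xi}{\epsilon})k$ we have $h(J)>2(\epsilon+\xi)$, then the algorithm rejects with probability at least $1-\delta$. Moreover, item (2) can be strengthened as follows: the algorithm rejects with probability at least $1-\delta$ whenever $h$ satisfies both (i) for every $J\subseteq[\ell]$ such that $|J|\ge\ell-k$, $h(J)>2\epsilon+2\xi$; and (ii) for every $J\subseteq[\ell]$ such that $|J|\ge\ell-2(1+\frac{\xi}{\epsilon})k$, $h(J)>\epsilon+2\xi$.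
   Context: A function $h\colon2^{[\ell]}\to\mathbb R$ is submodular if $h(J_1\cup\{i\})-h(J_1)\ge h(J_2\cup\{i\})-h(J_2)$ for all $J_1\subseteq J_2\subseteq[\ell]$ and $i\in[\ell]\setminus J_2$. An approximate oracle $\mathcal O^{\pm}_h$ for $h$ is a randomized algorithm that, for any input $J\subseteq[\ell]$ and parameters $\tau,\delta'\in(0,1)$, returns a value $\tilde h(J)$ with $|\tilde h(J)-h(J)|\le\tau$ with probability at least $1-\delta'$. An approximate submodular function minimization (ASFM) algorithm is an algorithm that, given access to an approximate oracle for a submodular function $g\colon2^{[\ell]}\to\mathbb R$ and parameters $\xi,\delta$, returns a value $\nu$ such that $|\nu-\min_{J\subseteq[\ell]}g(J)|\le\xi$ with probability at least $1-\delta$. Algorithm $\mathrm{ASMC}(\mathcal O^{\pm}_h,\epsilon,\delta,\xi,k)$: (a) let $h'(J)=h(J)-\frac{\epsilon}{k}|J|$, and simulate an approximate oracle for $h'$ by $\mathcal O^{\pm}_{h'}(J,\tau',\delta')=\mathcal O^{\pm}_h(J,\tau',\delta')-\frac{\epsilon}{k}|J|$; (b) let $\nu$ be the value returned by an ASFM algorithm with access to $\mathcal O^{\pm}_{h'}$ and parameters $\xi$ and $\delta$; (c) accept if and only if $\nu\le\left(1-\frac{\ell-k}{k}\right)\epsilon+\xi$. *)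

(* Defs.v *)
From HB Require Import structures.
From mathcomp Require Import all_boot all_order all_algebra.
From mathcomp Require Import all_classical all_reals all_analysis.
From mathcomp Require Import measurable_realfun.

Set Implicit Arguments.
Unset Strict Implicit.
Unset Printing Implicit Defensive.
Import Order.TTheory GRing.Theory Num.Theory.
Import numFieldNormedType.Exports.

Local Open Scope classical_set_scope.
Local Open Scope ring_scope.

(* The ground set [l] is 'I_l, and 2^[l] is {set 'I_l}. *)

Definition submodular (R : realType) (l : nat) (h : {set 'I_l} -> R) : Prop :=
  forall (J1 J2 : {set 'I_l}) (i : 'I_l), J1 \subset J2 -> i \notin J2 ->
    h (i |: J2) - h J2 <= h (i |: J1) - h J1.

(* The default value g finset.set0 is itself one of the values, so this is the
   minimum of g over all subsets. *)
Definition set_min (R : realType) (l : nat) (g : {set 'I_l} -> R) : R :=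
  \big[Num.min/g finset.set0]_(J : {set 'I_l}) g J.

(* A randomized algorithm is represented by the law of its output: an oracle
   maps a query (J, tau, delta') to the law of the real number it returns, each
   call being made with fresh randomness. *)
Definition oracle (R : realType) (l : nat) : Type :=
  {set 'I_l} -> R -> R -> probability (measurableTypeR R) R.

Definition approximate_oracle (R : realType) (l : nat)
    (h : {set 'I_l} -> R) (O : oracle R l) : Prop :=
  forall (J : {set 'I_l}) (tau delta' : R),
    0 < tau < 1 -> 0 < delta' < 1 ->
    ((1 - delta')%:E <= O J tau delta' [set x : R | (`|x - h J| <= tau)%R])%E.

(* A randomized algorithm with access to an oracle and with two real parameters
   xi and delta. Its output law is determined by the laws of the answers of the
   oracle, hence it is a map from oracles to laws; no restriction is put on how
   it uses the oracle. *)
Definition oracle_algorithm (R : realType) (l : nat) : Type :=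
  oracle R l -> R -> R -> probability (measurableTypeR R) R.

Definition ASFM_algorithm (R : realType) (l : nat)
    (A : oracle_algorithm R l) : Prop :=
  forall (g : {set 'I_l} -> R) (O : oracle R l) (xi delta : R),
    submodular g -> approximate_oracle g O ->
    0 < xi < 1 -> 0 < delta < 1 ->
    ((1 - delta)%:E <= A O xi delta [set nu : R | (`|nu - set_min g| <= xi)%R])%E.

Section measurable_post_processing.
Context (R : realType).

Definition subtract (c : R) (x : measurableTypeR R) : measurableTypeR R :=
  x - c.

Lemma measurable_subtract (c : R) : measurable_fun setT (subtract c).
Proof. by apply: measurable_funB; [exact: measurable_id|exact: measurable_cst]. Qed.

HB.instance Definition _ (c : R) :=
  isMeasurableFun.Build _ _ _ _ (subtract c) (measurable_subtract c).

Definition at_most (t : R) (x : measurableTypeR R) : bool := x <= t.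

Lemma measurable_at_most (t : R) : measurable_fun setT (at_most t).
Proof. by apply: measurable_fun_ler; [exact: measurable_id|exact: measurable_cst]. Qed.

HB.instance Definition _ (t : R) :=
  isMeasurableFun.Build _ _ _ _ (at_most t) (measurable_at_most t).

End measurable_post_processing.

(* [distribution P f] is the image of the law P under f: the law of the answer
   of the given oracle minus (eps / k) |J|. *)
Definition simulated_oracle (R : realType) (l : nat) (O : oracle R l)
    (eps : R) (k : nat) : oracle R l :=
  fun J tau delta' =>
    distribution (O J tau delta') (subtract (eps / k%:R * #|J|%:R)).

(* The law of the decision of the algorithm (true = accept, false = reject) when
   it uses A as ASFM algorithm. *)
Definition ASMC (R : realType) (l : nat) (A : oracle_algorithm R l)
    (O : oracle R l) (eps delta xi : R) (k : nat) : probability bool R :=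
  distribution (A (simulated_oracle O eps k) xi delta)
    (at_most ((1 - (l%:R - k%:R) / k%:R) * eps + xi)).

(* Main.v *)
(** Write [c = eps / k] and [g J = h J - c |J|], and let [T] be the acceptance
    threshold.  The minimum of [g] is at most [T - xi] as soon as some [J] with
    [|J| >= l - k] has [h J <= eps].  It exceeds [T + xi] as soon as
    [h J > 2 eps + 2 xi - c (l - |J|)] for all [J]; the right-hand side is at most
    [2 eps + 2 xi] always, less than [eps + 2 xi] when [|J| < l - k], and
    negative when [|J| < l - 2 (1 + xi / eps) k].  An estimate of the minimum with
    error at most [xi] therefore lands on the correct side of [T]. *)

Require Import Defs.
From HB Require Import structures.
From mathcomp Require Import all_boot all_order all_algebra.
From mathcomp Require Import all_classical all_reals all_analysis.
From mathcomp Require Import ring lra.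

Set Implicit Arguments.
Unset Strict Implicit.
Unset Printing Implicit Defensive.
Import Order.TTheory GRing.Theory Num.Theory.
Import numFieldNormedType.Exports.

Local Open Scope classical_set_scope.
Local Open Scope ring_scope.

Section SetMin.
Context (R : realType) (l : nat).
Implicit Types (g h : {set 'I_l} -> R) (J : {set 'I_l}).

Lemma set_min_le g J : set_min g <= g J.
Proof. exact: bigmin_le_cond. Qed.

Lemma lt_set_min g (x : R) : (forall J, x < g J) -> x < set_min g.
Proof. by move=> xg; apply/bigmin_gtP; split. Qed.

(** The subtracted term is modular: [i] lies outside [J2], hence outside [J1], so both marginals
    drop by the same [c]. *)
Lemma submodular_sub_card h (c : R) :
  submodular h -> submodular (fun J => h J - c * #|J|%:R).
Proof.
move=> hS J1 J2 i J12 iJ2; have iJ1 : i \notin J1.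
  by apply: contra iJ2; apply: (fintype.subsetP J12).
have := hS _ _ _ J12 iJ2.
rewrite !cardsU1 iJ1 iJ2 !natrD; lra.
Qed.

End SetMin.

(** The shift cancels in the error, so the good event for the simulated oracle is the good event for
    [O]. *)
Lemma approximate_simulated_oracle (R : realType) (l k : nat)
    (h : {set 'I_l} -> R) (O : oracle R l) (eps : R) :
  approximate_oracle h O ->
  approximate_oracle (fun J => h J - eps / k%:R * #|J|%:R)
    (simulated_oracle O eps k).
Proof.
move=> hO J tau d tau01 d01; apply: le_trans (hO J tau d tau01 d01) _.
rewrite /simulated_oracle /distribution /pushforward.
rewrite le_eqVlt; apply/orP; left; apply/eqP; congr (O J tau d _).
apply/seteqP; split => x /=; rewrite /subtract;
  by rewrite (_ : x - _ - _ = x - h J) //; ring.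
Qed.

Lemma measurable_dist_le (R : realType) (m r : R) :
  measurable ([set x : R | `|x - m| <= r] : set (measurableTypeR R)).
Proof.
rewrite (_ : [set x | _] = [set` `[m - r, m + r]]); first exact: measurable_itv.
by apply/seteqP; split => x /=; rewrite in_itv /= ler_distl.
Qed.

(** Reduces acceptance and rejection alike to a deterministic claim: the event that [nu] is
    [xi]-accurate lies inside the event that the decision is [b]. *)
Lemma ASMC_ge (R : realType) (l k : nat) (eps delta xi : R)
    (A : oracle_algorithm R l) (h : {set 'I_l} -> R) (O : oracle R l) (b : bool) :
  0 < delta < 1 -> 0 < xi < 1 ->
  ASFM_algorithm A -> submodular h -> approximate_oracle h O ->
  (forall nu : R,
     `|nu - set_min (fun J => h J - eps / k%:R * #|J|%:R)| <= xi ->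
     (nu <= (1 - (l%:R - k%:R) / k%:R) * eps + xi) = b) ->
  ((1 - delta)%:E <= ASMC A O eps delta xi k [set b])%E.
Proof.
move=> delta01 xi01 AP hS hO nub.
apply: le_trans (AP _ _ _ _ (submodular_sub_card (eps / k%:R) hS)
  (approximate_simulated_oracle k eps hO) xi01 delta01) _.
rewrite /ASMC /distribution /pushforward; apply: le_measure; rewrite ?inE.
- exact: measurable_dist_le.
- by rewrite -[_ @^-1` _]setTI; exact: measurable_at_most.
- by move=> nu /= /nub.
Qed.

Theorem theorem4p1 (R : realType) (l k : nat) (eps delta xi : R)
    (A : oracle_algorithm R l) (h : {set 'I_l} -> R) (O : oracle R l)
    (l_ge1 : (1 <= l)%N) (k_ge1 : (1 <= k)%N)
    (eps01 : 0 < eps < 1) (delta01 : 0 < delta < 1) (xi01 : 0 < xi < 1)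
    (A_ASFM : ASFM_algorithm A)
    (h_ge0 : forall J : {set 'I_l}, 0 <= h J)
    (h_submod : submodular h)
    (O_approx : approximate_oracle h O) :
  [/\ (exists J : {set 'I_l}, l%:R - k%:R <= #|J|%:R :> R /\ h J <= eps) ->
      ((1 - delta)%:E <= ASMC A O eps delta xi k [set true])%E,
      (forall J : {set 'I_l},
         l%:R - 2 * (1 + xi / eps) * k%:R <= #|J|%:R ->
         2 * (eps + xi) < h J) ->
      ((1 - delta)%:E <= ASMC A O eps delta xi k [set false])%E &
      (forall J : {set 'I_l},
         l%:R - k%:R <= #|J|%:R :> R -> 2 * eps + 2 * xi < h J) /\
      (forall J : {set 'I_l},
         l%:R - 2 * (1 + xi / eps) * k%:R <= #|J|%:R ->
         eps + 2 * xi < h J) ->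
      ((1 - delta)%:E <= ASMC A O eps delta xi k [set false])%E].
Proof.
have /andP[eps_gt0 _] := eps01; have /andP[xi_gt0 _] := xi01.
have k_gt0 : 0 < k%:R :> R by rewrite ltr0n.
have c_gt0 : 0 < eps / k%:R by rewrite divr_gt0.
have thresholdE : (1 - (l%:R - k%:R) / k%:R) * eps
    = 2 * eps - eps / k%:R * l%:R by field; rewrite gt_eqF.
have ckE : eps / k%:R * k%:R = eps by rewrite divfK ?gt_eqF.
(* The strengthened rejection comes first, as item (2) follows from it. *)
have reject : (forall J : {set 'I_l},
         l%:R - k%:R <= #|J|%:R :> R -> 2 * eps + 2 * xi < h J) /\
      (forall J : {set 'I_l},
         l%:R - 2 * (1 + xi / eps) * k%:R <= #|J|%:R ->
         eps + 2 * xi < h J) ->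
      ((1 - delta)%:E <= ASMC A O eps delta xi k [set false])%E.
  move=> [h_large h_medium]; apply: (ASMC_ge (h := h)) => // nu.
  rewrite ler_distl thresholdE => /andP[nu_ge _].
  apply/negbTE; rewrite -ltNge; apply: lt_le_trans nu_ge.
  (* One [xi] comes from the threshold, the other from the error of [nu]. *)
  rewrite ltrBrDr; apply: lt_set_min => J.
  have cJ : eps / k%:R * #|J|%:R <= eps / k%:R * l%:R.
    by rewrite ler_pM2l // ler_nat -[leqRHS](card_ord l) max_card.
  have [/h_large|] := leP (l%:R - k%:R) (#|J|%:R : R); first by lra.
  rewrite -(ltr_pM2l c_gt0) mulrBr ckE => J_lt.
  have [/h_medium|] := leP (l%:R - 2 * (1 + xi / eps) * k%:R) (#|J|%:R : R).
    by lra.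
  rewrite -(ltr_pM2l c_gt0) mulrBr.
  (* The factor [2 * (1 + xi / eps)] is chosen so that for such small [J] the bound [0 <= h J]
     suffices. *)
  have -> : eps / k%:R * (2 * (1 + xi / eps) * k%:R) = 2 * (eps + xi).
    by field; rewrite !gt_eqF.
  have := h_ge0 J; lra.
split=> //.
- move=> [J [J_ge hJ]]; apply: (ASMC_ge (h := h)) => // nu.
  rewrite ler_distl thresholdE => /andP[_ nu_le].
  apply: le_trans nu_le _; rewrite lerD2r; apply: le_trans (set_min_le _ J) _.
  (* Scaled by [eps / k], the size bound costs exactly [eps], which with [h J <= eps] gives the
     [2 * eps] of the threshold. *)
  by move: J_ge; rewrite -(ler_pM2l c_gt0) mulrBr ckE; lra.
- move=> h_big; apply: reject; split=> J J_ge.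
    (* Sets of size at least [l - k] also meet the weaker size bound of [h_big]. *)
    have : 0 <= xi / eps * k%:R by rewrite !mulr_ge0 ?invr_ge0 ?ltW.
    by move=> ?; rewrite -mulrDr; apply: h_big; lra.
  by have := h_big J J_ge; lra.
Qed.
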